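(* For every integer $n\ge1$ there exists a non-degenerate $LSSD(v,k,\lambda;w)$ with $v=36^{2n}$ and $w=4^n+1$, for some $k,\lambda$.
   Context: A symmetric $(v,k,\lambda)$-design consists of a set of $v$ points and a collection of $v$ blocks such that every block contains $k$ points, every point lies in $k$ blocks, every pair of distinct points lies in exactly $\lambda$ common blocks, and every pair of distinct blocks meets in exactly $\lambda$ points. Its incidence graph is the bipartite graph on points and blocks with a point adjacent to a block iff the point is in the block. A linked system of symmetric designs $LSSD(v,k,\lambda;w)$, $w\ge 2$, is a graph $\Gamma$ on $wv$ vertices whose vertex set is partitioned into $w$ sets (''fibers'') $X_1,\dots,X_w$ of size $v$ such that: (i) no edge has both ends in the same fiber; (ii) for all $i\ne j$, the subgraph of $\Gamma$ induced between $X_i$ and $X_j$ is the incidence graph of some symmetric $(v,k,\lambda)$-design; (iii) there are constants $\mu,\nu$ such that for all distinct $h,i,j$ and all $a\in X_i$, $b\in X_j$, the number of common neighbours of $a$ and $b$ lying in $X_h$ is $\mu$ if $a\sim b$ and $\nu$ if $a\not\sim b$. It is non-degenerate if $1<k<v-1$. *)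

(* Defs.v *)
From mathcomp Require Import all_boot.

Set Implicit Arguments.
Unset Strict Implicit.
Unset Printing Implicit Defensive.

(* Blocks form a type of their own, related to points by [inc], so that a
   "collection" of blocks is not forced to be repetition-free. *)
Record symmetric_design (P B : finType) (inc : P -> B -> bool)
    (v k lambda : nat) : Prop := SymmetricDesign {
  card_points : #|P| = v;
  card_blocks : #|B| = v;
  card_block : forall b : B, #|[set p | inc p b]| = k;
  card_point_blocks : forall p : P, #|[set b | inc p b]| = k;
  card_common_blocks : forall p q : P, p != q ->
    #|[set b | inc p b && inc q b]| = lambda;
  card_block_meet : forall b c : B, b != c ->
    #|[set p | inc p b && inc p c]| = lambda
}.

Definition incidence_graph (P B : finType) (inc : P -> B -> bool) :
    rel (P + B) :=
  fun x y =>
    match x, y with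
    | inl p, inr b | inr b, inl p => inc p b
    | _, _ => false
    end.

(* The graph induced by [adj] between [X] and [Y] is, up to isomorphism, the
   incidence graph of a symmetric design, with points in [X] and blocks in
   [Y]. The isomorphism also forbids edges inside [X] and inside [Y]. *)
Definition design_graph_between (T : finType) (adj : rel T) (X Y : {set T})
    (v k lambda : nat) : Prop :=
  exists (P B : finType) (inc : P -> B -> bool) (f : P + B -> T),
    [/\ symmetric_design inc v k lambda,
        injective f,
        f @: [set inl p | p : P] = X,
        f @: [set inr b | b : B] = Y
      & forall x y, adj (f x) (f y) = incidence_graph inc x y].

Definition simple_graph (T : finType) (adj : rel T) : Prop :=
  symmetric adj /\ irreflexive adj.

Record fibers (T : finType) (v w : nat) (X : 'I_w -> {set T}) : Prop :=
  Fibers {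
  fiber_card : forall i, #|X i| = v;
  fiber_disjoint : forall i j, i != j -> [disjoint X i & X j];
  fiber_cover : \bigcup_i X i = [set: T]
}.

Record LSSD_on (T : finType) (adj : rel T) (v k lambda w : nat)
    (X : 'I_w -> {set T}) : Prop := LSSDOn {
  LSSD_fibers : fibers v X;
  LSSD_no_inner_edge : forall i a b, a \in X i -> b \in X i -> ~~ adj a b;
  LSSD_design : forall i j, i != j ->
    design_graph_between adj (X i) (X j) v k lambda;
  LSSD_linked : exists mu nu : nat,
    forall h i j, h != i -> h != j -> i != j ->
    forall a b, a \in X i -> b \in X j ->
      #|[set c in X h | adj a c && adj b c]| = if adj a b then mu else nu
}.

Definition LSSD (T : finType) (adj : rel T) (v k lambda w : nat) : Prop :=
  [/\ 2 <= w,
      simple_graph adj,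
      #|T| = w * v
    & exists X : 'I_w -> {set T}, LSSD_on adj v k lambda X].

Definition nondegenerate (v k : nat) : Prop := 1 < k < v - 1.

(* Main.v *)
Require Import Defs.
From mathcomp Require Import all_boot.
From mathcomp Require Import ssralg ssrint finalg finfield zify ring.

(** The system is built from real mutually unbiased bases of dimension
[s ^ 2], where [s = 36 ^ n].

Take a net of order [s]: [s ^ 2] points and several parallel classes, each
cutting the points into [s] lines of [s] points, with lines of different
classes meeting in exactly one point.  Take also a Hadamard matrix [H] of
order [s].  For each line and each row of [H], copy the row onto the points of
the line and extend it by zero.  The [s ^ 2] vectors obtained from one class
form an orthogonal basis (vectors of norm [s]), and vectors from different
classes overlap in a single point, so that their inner product is [1] or
[-1].  The fibers are these bases, and two vectors of different bases are
adjacent when their inner product is [1].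

For [a], [b] outside the basis [X], completeness of [X] gives
[\sum_(c in X) <a, c> * <c, b> = s * <a, b>].  If moreover all the row and
column sums of [H] are equal to [r] with [r ^ 2 = s], then the members of [X]
add up to [r] times the all-one vector, and
[\sum_(c in X) <a, c> = r * r = s].  Expanding
[\sum_(c in X) (1 + <a, c>) * (1 + <b, c>)], the number of common neighbours
of [a] and [b] in [X] is [(s ^ 2 + 2 * s + s * <a, b>) / 4]
([common_neighbours]).  It depends on [<a, b>] only, which is [s] when
[a = b], [0] when [a] and [b] are distinct members of one basis, and [1] or
[-1] when they lie in different bases: this gives the four constants
[k], [lambda], [mu] and [nu] at once ([LSSD_of_net]).

Both ingredients exist for [s = 36 ^ n].  The affine planes over the fields
with [4 ^ n] and [9 ^ n] elements are nets with [4 ^ n + 1] and [9 ^ n + 1]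
classes, and multiplying them class by class leaves a net of order [36 ^ n]
with [4 ^ n + 1] classes ([net_exists]).  The cyclic Latin square of order 6
yields a symmetric Hadamard matrix of order 36 with row sums 6, and
its tensor powers have order [36 ^ n] and row sums [6 ^ n]
([reg_hadamard_exists]). *)

Set Implicit Arguments.
Unset Strict Implicit.
Unset Printing Implicit Defensive.

Import GRing.Theory.

(** * Regular symmetric Hadamard matrices *)

(** Symmetry is imposed so that orthogonality and constant sums pass from the
rows to the columns. *)
Record reg_hadamard (L : finType) (h : L -> L -> int) (r : int) : Prop :=
  RegHadamard {
  hadamard_sign : forall x y, h x y = 1%R \/ h x y = (-1)%R;
  hadamard_sym : forall x y, h x y = h y x;
  hadamard_ortho : forall x y,
    (\sum_z h x z * h y z = #|L|%:Z * (x == y)%:Z)%R;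
  hadamard_rowsum : forall x, (\sum_z h x z = r)%R;
  hadamard_sum_sqr : (r * r = #|L|%:Z)%R
}.

Lemma reg_hadamard_transport (K L : finType) (h : K -> K -> int) r :
  #|L| = #|K| -> reg_hadamard h r ->
  exists h' : L -> L -> int, reg_hadamard h' r.
Proof.
move=> eqLK [sg sy ort rs sq].
pose f (x : L) : K := enum_val (cast_ord eqLK (enum_rank x)).
pose g (y : K) : L := enum_val (cast_ord (esym eqLK) (enum_rank y)).
have fK : cancel f g by move=> x; rewrite /f /g enum_valK cast_ordK enum_rankK.
have gK : cancel g f by move=> x; rewrite /f /g enum_valK cast_ordKV enum_rankK.
have bij_f : {on predT, bijective f} by exists g => x _.
exists (fun x y => h (f x) (f y)); split=> [x y|x y|x y|x|].
- exact: sg.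
- exact: sy.
- by rewrite -(reindex f (P := predT) (F := fun z => h (f x) z * h (f y) z)%R)
    // ort eqLK (can_eq fK).
- by rewrite -(reindex f (P := predT) (F := fun z => h (f x) z)).
- by rewrite sq eqLK.
Qed.

Lemma reg_hadamard_tensor (K L : finType) (h : K -> K -> int) r
    (h' : L -> L -> int) r' :
  reg_hadamard h r -> reg_hadamard h' r' ->
  reg_hadamard (fun x y : K * L => h x.1 y.1 * h' x.2 y.2)%R (r * r')%R.
Proof.
case=> sg sy ort rs sq [sg' sy' ort' rs' sq']; split=> [x y|x y|x y|x|].
- by case: (sg x.1 y.1) => ->; case: (sg' x.2 y.2) => ->;
    [left | right | right | left].
- by rewrite sy sy'.
- transitivity (\sum_z1 \sum_z2
      (h x.1 z1 * h y.1 z1) * (h' x.2 z2 * h' y.2 z2))%R.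
    by rewrite pair_bigA; apply: eq_bigr => z _ /=; ring.
  rewrite -big_distrlr /= ort ort' card_prod -pair_eqE /pair_eq /= PoszM.
  by case: eqP; case: eqP => _ _ /=; ring.
- transitivity (\sum_z1 \sum_z2 h x.1 z1 * h' x.2 z2)%R.
    by rewrite pair_bigA.
  by rewrite -big_distrlr /= rs rs'.
- by rewrite card_prod PoszM -sq -sq'; ring.
Qed.

(** The cells of the Cayley table of Z/6 are numbered from 0 to 35; distinct
cells are joined when they share their row, their column or their symbol.
This Latin square graph is strongly regular with parameters (36, 15, 6, 6),
whose adjacency matrix [A] satisfies [A ^ 2 = 9 I + 6 J]; the sign matrix is
[J - 2 A], with square [36 I] and row sums [36 - 30]. *)
Definition latin6_sign (x y : nat) : int :=
  if (x != y) && [|| x %/ 6 == y %/ 6, x %% 6 == y %% 6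
                   | (x %/ 6 + x %% 6) %% 6 == (y %/ 6 + y %% 6) %% 6]
  then (-1)%R else 1%R.

Lemma reg_hadamard36 :
  reg_hadamard (fun x y : 'I_36 => latin6_sign x y) 6%:Z.
Proof.
(* Sums over ['I_36] are evaluated as folds over [iota 0 36]. *)
have sumE (F : nat -> int) :
    (\sum_(z : 'I_36) F z = foldr (fun i a => F i + a) 0 (iota 0 36))%R.
  by rewrite -(big_mkord xpredT) unlock.
have allE (p : pred nat) : all p (iota 0 36) -> forall x : 'I_36, p x.
  by move=> /allP pP x; apply: pP; rewrite mem_iota /= ltn_ord.
split=> [x y|x y|x y|x|].
- by rewrite /latin6_sign; case: ifP; [right | left].
- rewrite /latin6_sign eq_sym (eq_sym (y %/ 6)) (eq_sym (y %% 6)).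
  by rewrite (eq_sym ((y %/ 6 + y %% 6) %% 6)).
- rewrite (sumE (fun z => latin6_sign x z * latin6_sign y z)%R) card_ord.
  rewrite -val_eqE /=; apply/eqP.
  pose orth (i j : nat) := foldr (fun z a => latin6_sign i z * latin6_sign j z
    + a)%R 0%R (iota 0 36) == (36%:Z * (i == j)%:Z)%R.
  suff /allE/(_ x)/allE/(_ y) : all (fun i => all (orth i) (iota 0 36))
    (iota 0 36) by [].
  by vm_compute.
- rewrite (sumE (fun z => latin6_sign x z)); apply/eqP.
  pose row6 (i : nat) :=
    foldr (fun z a => latin6_sign i z + a)%R 0%R (iota 0 36) == 6%:Z%R.
  suff /allE/(_ x) : all row6 (iota 0 36) by [].
  by vm_compute.
- by rewrite card_ord.
Qed.

Lemma reg_hadamard_exists (n : nat) (L : finType) : #|L| = 36 ^ n ->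
  exists (h : L -> L -> int) (r : int), reg_hadamard h r.
Proof.
elim: n L => [|n IHn] L cardL.
  have [h hP] : exists h : L -> L -> int, reg_hadamard h 1%R.
    apply: (@reg_hadamard_transport unit L (fun _ _ => 1%R)).
      by rewrite cardL card_unit.
    by split=> [||[] []||]; rewrite ?big_const ?card_unit //; left.
  by exists h, 1%R.
have [h [r hP]] := IHn 'I_(36 ^ n) (card_ord _).
have cardE : #|L| = #|{: 'I_36 * 'I_(36 ^ n)}|.
  by rewrite card_prod !card_ord -expnS.
have [h' h'P] :=
  reg_hadamard_transport cardE (reg_hadamard_tensor reg_hadamard36 hP).
by exists h', (6%:Z * r)%R.
Qed.

(** * Nets *)

(** The points are the pairs of labels, and [c i p] is the label of the line
of class [i] through [p].  As there are as many pairs of labels as points,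
injectivity already says that two lines of different classes meet in exactly
one point. *)
Definition net (I : eqType) (L : Type) (c : I -> L * L -> L) : Prop :=
  forall i j, i != j -> injective (fun p => (c i p, c j p)).

(** The lines of the affine plane over [F]: [y - a * x = const], together with
the vertical lines as the class [None]. *)
Definition affine_class (F : fieldType) (a : option F) (p : F * F) : F :=
  if a is Some a then (p.2 - a * p.1)%R else p.1.

Lemma affine_net (F : fieldType) : net (@affine_class F).
Proof.
move=> [a|] [b|] //= ab [x y] [x' y'] /= [].
- move=> e1 e2.
  have /eqP : ((a - b) * (x - x') = 0)%R.
    have -> : ((a - b) * (x - x')
        = ((y - b * x) - (y' - b * x')) - ((y - a * x) - (y' - a * x')))%R.
      by ring.
    by rewrite e1 e2 !subrr.
  rewrite mulf_eq0 !subr_eq0 => /orP[/eqP ab0|/eqP xx'].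
    by rewrite ab0 eqxx in ab.
  by move: e1; rewrite xx' => /addIr ->.
- by move=> + xx'; rewrite xx' => /addIr ->.
- by move=> ->; move=> /addIr ->.
Qed.

Lemma net_prod (I : eqType) (L M : Type) (c : I -> L * L -> L)
    (d : I -> M * M -> M) :
  net c -> net d ->
  net (fun i (p : (L * M) * (L * M)) =>
         (c i (p.1.1, p.2.1), d i (p.1.2, p.2.2))).
Proof.
move=> cP dP i j ij [[x1 x2] [y1 y2]] [[x1' x2'] [y1' y2']] /= [c1 d1 c2 d2].
have [-> ->] := cP i j ij (x1, y1) (x1', y1') (congr2 pair c1 c2).
by have [-> ->] := dP i j ij (x2, y2) (x2', y2') (congr2 pair d1 d2).
Qed.

Lemma net_reindex (I J : eqType) (L : Type) (f : J -> I)
    (c : I -> L * L -> L) :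
  injective f -> net c -> net (fun j => c (f j)).
Proof. by move=> f_inj cP i j ij; apply: cP; rewrite inj_eq. Qed.

Lemma ord_inj_exists (w : nat) (T : finType) : w <= #|T| ->
  exists f : 'I_w -> T, injective f.
Proof.
move=> le_wT; exists (fun i => enum_val (widen_ord le_wT i)).
by move=> i j /enum_val_inj /(congr1 val) /= /val_inj.
Qed.

Lemma net_exists (n : nat) : 0 < n ->
  exists (L : finType) (c : 'I_(4 ^ n + 1) -> L * L -> L),
    #|L| = 36 ^ n /\ net c.
Proof.
move=> n_gt0.
have n2_gt0 : 0 < 2 * n by rewrite muln_gt0.
have [F _ cardF] := @PrimePowerField 2 (2 * n) isT n2_gt0.
have [K _ cardK] := @PrimePowerField 3 (2 * n) isT n2_gt0.
rewrite !expnM in cardF cardK.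
have [f f_inj] : exists f : 'I_(4 ^ n + 1) -> option F, injective f.
  by apply: ord_inj_exists; rewrite card_option cardF addn1.
have [g g_inj] : exists g : 'I_(4 ^ n + 1) -> option K, injective g.
  by apply: ord_inj_exists; rewrite card_option cardK addn1 ltnS leq_exp2r.
exists (F * K)%type, (fun i p => (affine_class (f i) (p.1.1, p.2.1),
                                  affine_class (g i) (p.1.2, p.2.2))).
split; first by rewrite card_prod cardF cardK -expnMn.
exact: (net_prod (net_reindex f_inj (@affine_net F))
                 (net_reindex g_inj (@affine_net K))).
Qed.

(** * Unbiased bases from a net and a Hadamard matrix *)

Section UnbiasedBases.

Local Open Scope ring_scope.

Variables (I : eqType) (L : finType) (c : I -> L * L -> L).
(** [q i p] is the position of the point [p] on its line of class [i]. *)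
Variables (q : I -> L * L -> L) (h : L -> L -> int) (r : int).
Hypothesis c_net : net c.
Hypothesis q_pos : forall i, injective (fun p => (c i p, q i p)).
Hypothesis h_had : reg_hadamard h r.

Let s : int := #|L|%:Z.

(** [base i (l, t)] is row [t] of the matrix, copied onto line [l] of class
[i]. *)
Definition base (i : I) (u : L * L) (p : L * L) : int :=
  (c i p == u.1)%:Z * h u.2 (q i p).

Definition inner (x y : I * (L * L)) : int :=
  \sum_p base x.1 x.2 p * base y.1 y.2 p.

Lemma innerC x y : inner x y = inner y x.
Proof. by apply: eq_bigr => p _; rewrite mulrC. Qed.

Lemma sum_eqL (l : L) (F : L -> int) : \sum_m (m == l)%:Z * F m = F l.
Proof.
rewrite (bigD1 l) //= eqxx mul1r big1 ?addr0 // => m /negbTE ->.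
by rewrite mul0r.
Qed.

Lemma inner_same i u u' : inner (i, u) (i, u') = s * (u == u')%:Z.
Proof.
rewrite /inner /base /=.
transitivity (\sum_l \sum_t
    ((l == u.1)%:Z * (l == u'.1)%:Z) * (h u.2 t * h u'.2 t)).
  rewrite pair_bigA /= [RHS](reindex_inj (@q_pos i)) /=.
  by apply: eq_bigr => p _; ring.
rewrite -big_distrlr /= sum_eqL (hadamard_ortho h_had).
by rewrite -pair_eqE /pair_eq /=; do 2!case: eqP => _ /=; rewrite /s; ring.
Qed.

Lemma inner_distinct i j u u' : i != j ->
  inner (i, u) (j, u') = 1 \/ inner (i, u) (j, u') = -1.
Proof.
move=> ij; have [p0 p0P] : exists p, (c i p, c j p) = (u.1, u'.1).
  have [g _ gK] := injF_bij (c_net ij).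
  by exists (g (u.1, u'.1)); apply: gK.
case: (p0P) => cip0 cjp0.
rewrite /inner /base /= (bigD1 p0) //= big1 => [|p pp0].
  rewrite cip0 cjp0 !eqxx !mul1r addr0.
  by case: (hadamard_sign h_had u.2 (q i p0)) => ->;
     case: (hadamard_sign h_had u'.2 (q j p0)) => ->; (by left) || (by right).
case: eqP => [cip|_]; last by rewrite !mul0r.
case: eqP => [cjp|_]; last by rewrite mul0r mulr0.
by case/eqP: pp0; apply: (c_net ij); rewrite p0P cip cjp.
Qed.

(** An orthogonal basis is complete: the Gram matrix of its transpose is
scalar as well. *)
Lemma base_complete i p p' :
  \sum_u base i u p * base i u p' = s * (p == p')%:Z.
Proof.
transitivity (\sum_l \sum_t ((l == c i p)%:Z * (l == c i p')%:Z)
   * (h (q i p) t * h (q i p') t)).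
  rewrite pair_bigA; apply: eq_bigr => u _ /=.
  rewrite /base !(eq_sym u.1) !(hadamard_sym h_had u.2); ring.
rewrite -big_distrlr /= sum_eqL (hadamard_ortho h_had).
by rewrite -(inj_eq (@q_pos i)) -pair_eqE /pair_eq /=;
   do 2!case: eqP => _ /=; rewrite /s; ring.
Qed.

Lemma sum_base i p : \sum_u base i u p = r.
Proof.
transitivity (\sum_l \sum_t (l == c i p)%:Z * h (q i p) t).
  rewrite pair_bigA; apply: eq_bigr => u _ /=.
  by rewrite /base eq_sym (hadamard_sym h_had u.2).
by rewrite exchange_big /=; under eq_bigr do rewrite sum_eqL;
   exact: (hadamard_rowsum h_had).
Qed.

Lemma base_sum i u : \sum_p base i u p = r.
Proof.
transitivity (\sum_l \sum_t (l == u.1)%:Z * h u.2 t).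
  by rewrite pair_bigA /= [RHS](reindex_inj (@q_pos i)).
by rewrite exchange_big /=; under eq_bigr do rewrite sum_eqL;
   exact: (hadamard_rowsum h_had).
Qed.

Lemma sum_inner m x : \sum_u inner x (m, u) = s.
Proof.
rewrite exchange_big /=; under eq_bigr do rewrite -mulr_sumr sum_base.
by rewrite -mulr_suml base_sum (hadamard_sum_sqr h_had).
Qed.

(** Parseval's identity for the basis [m]. *)
Lemma sum_inner_inner m x y :
  \sum_u inner x (m, u) * inner y (m, u) = s * inner x y.
Proof.
transitivity (\sum_p \sum_p' (base x.1 x.2 p * base y.1 y.2 p')
    * \sum_u base m u p * base m u p').
  under eq_bigr do rewrite /inner big_distrlr /=.
  rewrite exchange_big; apply: eq_bigr => p _.
  rewrite exchange_big; apply: eq_bigr => p' _.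
  by rewrite mulr_sumr; apply: eq_bigr => u _; ring.
rewrite mulr_sumr; apply: eq_bigr => p _.
rewrite (bigD1 p) //= base_complete eqxx big1 => [|p' /negbTE pp'].
  by rewrite addr0 mulr1 mulrC.
by rewrite base_complete eq_sym pp' !mulr0.
Qed.

Definition unbiased_adj : rel (I * (L * L)) :=
  fun x y => (x.1 != y.1) && (inner x y == 1).

Lemma inner_adj x y : x.1 != y.1 ->
  inner x y = if unbiased_adj x y then 1 else -1.
Proof.
case: x y => [i u] [j u'] /= ij; rewrite /unbiased_adj /= ij /=.
by case: (inner_distinct u u' ij) => ->.
Qed.

Lemma common_neighbours m x y : m != x.1 -> m != y.1 ->
  4 * #|[set u | unbiased_adj x (m, u) && unbiased_adj y (m, u)]|%:Z
  = s * s + 2 * s + s * inner x y.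
Proof.
move=> mx my.
transitivity (\sum_u (1 + inner x (m, u)) * (1 + inner y (m, u))).
  rewrite -sum1_card big_mkcond /= (big_morph Posz PoszD (erefl _)) mulr_sumr.
  apply: eq_bigr => u _; rewrite inE !inner_adj 1?eq_sym //.
  by do 2!case: unbiased_adj.
transitivity (\sum_(u : L * L) 1 + \sum_u inner x (m, u) +
   \sum_u inner y (m, u) + \sum_u inner x (m, u) * inner y (m, u)).
  by rewrite -!big_split /=; apply: eq_bigr => u _; ring.
rewrite !sum_inner sum_inner_inner sumr_const card_prod natrM.
by rewrite !natz /s; ring.
Qed.

End UnbiasedBases.

(** * The linked system *)

Section LinkedSystem.

Variables (w t : nat) (L : finType) (c : 'I_w -> L * L -> L).
Variables (h : L -> L -> int) (r : int).
Hypothesis w_gt1 : 1 < w.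
Hypothesis cardL : #|L| = 4 * t.
Hypothesis c_net : net c.
Hypothesis h_had : reg_hadamard h r.

(** The order is written [4 * t] because the parameters involve quarters of
[s]. *)
Theorem LSSD_of_net : exists adj : rel ('I_w * (L * L)),
  LSSD adj ((4 * t) ^ 2) (8 * t ^ 2 + 2 * t) (4 * t ^ 2 + 2 * t) w.
Proof.
(* Any other class tells apart the points of a line. *)
pose i0 := Ordinal (ltnW w_gt1); pose i1 := Ordinal w_gt1.
pose q i := c (if i == i0 then i1 else i0).
have q_pos i : injective (fun p => (c i p, q i p)).
  by apply: c_net; have [->|//] := eqVneq i i0.
pose adj := unbiased_adj c q h; exists adj.
have adjC : symmetric adj.
  by move=> x y; rewrite /adj /unbiased_adj eq_sym innerC.
have count m x y : m != x.1 -> m != y.1 ->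
    (#|[set u | adj x (m, u) && adj y (m, u)]|%:Z * 4
     = (4 * t ^ 2 + 2 * t)%:Z * 4 + (4 * t)%:Z * inner c q h x y)%R.
  move=> mx my; rewrite mulrC (common_neighbours c_net q_pos h_had mx my) cardL.
  by ring.
have inj4 (a b : int) : (a * 4 = b * 4)%R -> a = b by lia.
have count_nbr m i u : m != i ->
    #|[set v | adj (i, u) (m, v)]| = 8 * t ^ 2 + 2 * t.
  move=> mi; apply/eqP; rewrite -eqz_nat; apply/eqP/inj4.
  have -> : [set v | adj (i, u) (m, v)]
          = [set v | adj (i, u) (m, v) && adj (i, u) (m, v)].
    by apply/setP=> v; rewrite !inE andbb.
  rewrite count // (inner_same q_pos h_had) eqxx mulr1 cardL.
  by ring.
have count_same m i u u' : m != i -> u != u' ->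
    #|[set v | adj (i, u) (m, v) && adj (i, u') (m, v)]| = 4 * t ^ 2 + 2 * t.
  move=> mi /negbTE uu'; apply/eqP; rewrite -eqz_nat; apply/eqP/inj4.
  by rewrite count // (inner_same q_pos h_had) uu' !mulr0 addr0.
pose X (i : 'I_w) := [set x : 'I_w * (L * L) | x.1 == i].
have XE i : X i = [set (i, u) | u : L * L].
  apply/setP=> -[j u]; rewrite inE /=; apply/eqP/imsetP => [->|[v _ [-> _]] //].
  by exists u.
have pair_inj (i : 'I_w) : injective (fun u : L * L => (i, u)) by move=> u v [].
split=> //.
- split=> // x; by rewrite /adj /unbiased_adj eqxx.
- by rewrite !card_prod card_ord cardL expnS expn1.
exists X; split.
- split=> [i|i j ij|].
  + by rewrite XE card_imset // card_prod cardL expnS expn1.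
  + rewrite -setI_eq0; apply/eqP/setP=> x; rewrite !inE.
    by apply/negP=> /andP[/eqP -> /eqP ij']; rewrite ij' eqxx in ij.
  + by apply/setP=> x; rewrite inE; apply/bigcupP; exists x.1; rewrite ?inE.
- move=> i a b; rewrite !inE => /eqP ai /eqP bi.
  by rewrite /adj /unbiased_adj ai bi eqxx.
- move=> i j ij.
  exists (L * L)%type, (L * L)%type, (fun u v => adj (i, u) (j, v)).
  exists (fun z => match z with inl u => (i, u) | inr v => (j, v) end).
  have ji : j != i by rewrite eq_sym.
  split.
  + have cardLL : #|{: L * L}| = (4 * t) ^ 2.
      by rewrite card_prod cardL expnS expn1.
    split=> // [b|p|p p' pp'|b b' bb'].
    * rewrite -(count_nbr i j b) //.
      by apply: eq_card => p; rewrite !inE adjC.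
    * exact: count_nbr.
    * exact: count_same.
    * rewrite -(count_same i j b b') //.
      by apply: eq_card => p; rewrite !inE !(adjC (i, p)).
  + move=> [u|u] [v|v] [] //; try by move=> ->.
      by move=> ij'; rewrite ij' eqxx in ij.
    by move=> ij'; rewrite ij' eqxx in ij.
  + by rewrite -imset_comp XE; apply: eq_imset.
  + by rewrite -imset_comp XE; apply: eq_imset.
  + move=> [u|u] [v|v] //=.
    * by rewrite /adj /unbiased_adj eqxx.
    * by rewrite /adj /unbiased_adj eqxx.
- exists (4 * t ^ 2 + 3 * t), (4 * t ^ 2 + t) => m i j mi mj ij [i' u] [j' v].
  rewrite !inE /= => /eqP -> /eqP ->.
  have -> : #|[set x in X m | adj (i, u) x && adj (j, v) x]|
          = #|[set z | adj (i, u) (m, z) && adj (j, v) (m, z)]|.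
    rewrite -(card_imset _ (pair_inj m)); apply: eq_card => -[m' z].
    rewrite !inE /=; apply/andP/imsetP => [[/eqP -> adjz]|[z']].
      by exists z; rewrite ?inE.
    by rewrite inE => adjz [-> ->]; rewrite eqxx.
  apply/eqP; rewrite -eqz_nat; apply/eqP/inj4.
  rewrite count // (inner_adj q c_net h_had) // -/adj.
  by case: ifP => _; ring.
Qed.

End LinkedSystem.

Theorem corollary8p9 (n : nat) (hn : 1 <= n) :
  exists (k lambda : nat) (T : finType) (adj : rel T),
    LSSD adj (36 ^ (2 * n)) k lambda (4 ^ n + 1)
    /\ nondegenerate (36 ^ (2 * n)) k.
Proof.
have [L [c [cardL c_net]]] := net_exists hn.
have [h [r h_had]] := reg_hadamard_exists cardL.
pose t := 9 * 36 ^ n.-1.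
have orderE : 36 ^ n = 4 * t by rewrite mulnA -expnS prednK.
have w_gt1 : 1 < 4 ^ n + 1 by rewrite addn1 ltnS expn_gt0.
rewrite orderE in cardL.
have [adj adjP] := LSSD_of_net w_gt1 cardL c_net h_had.
have vE : 36 ^ (2 * n) = (4 * t) ^ 2 by rewrite mulnC expnM orderE.
exists (8 * t ^ 2 + 2 * t), (4 * t ^ 2 + 2 * t), _, adj; rewrite vE.
split=> //.
have t_gt0 : 0 < t by rewrite muln_gt0 expn_gt0.
rewrite /nondegenerate; nia.
Qed.
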